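(* Let $m\ge1$, $k\ge m$ and $h$ be integers. The generating function $\sum_{n\ge0}d(n)q^n$, where $d(n)$ is the number of partitions $\lambda$ of $n$ into distinct parts with an $h$-fixed hook in the $m$th column arising from a part of size $k$ (i.e. there is a row $s$ with $\lambda_s=k$ and $h_{s,m}(\lambda)=s+h$), is \[ \sum_{s=0}^{k-m}\frac{q^{s(k+m)+k(k-h-m+1)+\binom{s+k-m+1-h}{2}+\binom{s}{2}}\,(-q;q)_{m-1}}{(q;q)_{s+k-h-m}}\binom{k-m}{s}_q . \]
   Context: For a partition $\lambda$ with conjugate $\lambda'$, $h_{i,j}(\lambda)=\lambda_i+\lambda'_j-i-j+1$ is the hook length of cell $(i,j)$, $j\le\lambda_i$. Notation: $(a;b)_n=\prod_{t=0}^{n-1}(1-ab^t)$; $\binom{a}{b}_q=\frac{(q;q)_a}{(q;q)_b(q;q)_{a-b}}$ is the Gaussian binomial coefficient; $\binom{x}{2}=x(x-1)/2$ is the ordinary binomial coefficient; conventionally $1/(q;q)_j=0$ for $j<0$. *)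

(* Defs.v *)
From HB Require Import structures.
From mathcomp Require Import all_boot all_order all_algebra.
From mathcomp Require Import boolp zify.

Set Implicit Arguments.
Unset Strict Implicit.
Unset Printing Implicit Defensive.

Import Order.TTheory GRing.Theory Num.Theory.
Local Open Scope ring_scope.

(* The ring of formal power series R[[q]] over a commutative ring R; a series
   is its sequence of coefficients.  Equality is decided classically. *)
Record fps (R : Type) := Fps { fcoef :> nat -> R }.

HB.instance Definition _ (R : Type) := gen_eqMixin (fps R).
HB.instance Definition _ (R : Type) := gen_choiceMixin (fps R).

Lemma fpsP (R : Type) (f g : fps R) : f =1 g <-> f = g.
Proof.
by split=> [|-> //]; case: f g => f [g] /= fg; congr Fps; apply/funext.
Qed.

Section FpsRing.
Variable R : comNzRingType.
Implicit Types f g : fps R.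

Definition fps_zero : fps R := Fps (fun _ => 0).
Definition fps_opp f : fps R := Fps (fun n => - f n).
Definition fps_add f g : fps R := Fps (fun n => f n + g n).
Definition fps_one : fps R := Fps (fun n => (n == 0%N)%:R).
Definition fps_mul f g : fps R :=
  Fps (fun n => \sum_(i < n.+1) f i * g (n - i)%N).

Fact fps_addA : associative fps_add.
Proof. by move=> f g e; apply/fpsP => n /=; rewrite addrA. Qed.
Fact fps_addC : commutative fps_add.
Proof. by move=> f g; apply/fpsP => n /=; rewrite addrC. Qed.
Fact fps_add0 : left_id fps_zero fps_add.
Proof. by move=> f; apply/fpsP => n /=; rewrite add0r. Qed.
Fact fps_addN : left_inverse fps_zero fps_opp fps_add.
Proof. by move=> f; apply/fpsP => n /=; rewrite addNr. Qed.

HB.instance Definition _ := GRing.isZmodule.Build (fps R)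
  fps_addA fps_addC fps_add0 fps_addN.

Fact fps_mulC : commutative fps_mul.
Proof.
move=> f g; apply/fpsP => n /=; rewrite (reindex_inj rev_ord_inj) /=.
by apply: eq_bigr => i _; rewrite mulrC subSS subKn // -ltnS.
Qed.

Fact fps_mulA : associative fps_mul.
Proof.
(* the coefficient of index n only depends on the truncations of the factors,
   for which associativity is that of {poly R} *)
move=> f g e; apply/fpsP => n /=.
pose T (u : fps R) : {poly R} := \poly_(i < n.+1) u i.
have TM u v i : (i <= n)%N -> fps_mul u v i = (T u * T v)`_i.
  move=> le_in; rewrite coefM; apply: eq_bigr => j _.
  by rewrite !coef_poly !ltnS (leq_trans (leq_subr _ _) le_in)
             (leq_trans _ le_in) // -ltnS.
transitivity (T f * (T g * T e))`_n; last rewrite mulrA.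
  rewrite coefM; apply: eq_bigr => i _.
  by rewrite -TM ?leq_subr // coef_poly ltn_ord.
rewrite coefM; apply: eq_bigr => i _.
by rewrite -TM -1?ltnS // coef_poly ltnS leq_subr.
Qed.

Fact fps_mul1 : left_id fps_one fps_mul.
Proof.
move=> f; apply/fpsP => n /=; rewrite big_ord_recl /= mul1r subn0.
by rewrite big1 ?addr0 // => i _; rewrite mul0r.
Qed.

Fact fps_mulDl : left_distributive fps_mul fps_add.
Proof.
move=> f g e; apply/fpsP => n /=; rewrite -big_split /=.
by apply: eq_bigr => i _; rewrite mulrDl.
Qed.

Fact fps_one_neq0 : fps_one != fps_zero.
Proof. by apply/eqP => /fpsP /(_ 0%N) /eqP; rewrite /= oner_eq0. Qed.

HB.instance Definition _ := GRing.Zmodule_isComNzRing.Build (fps R)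
  fps_mulA fps_mulC fps_mul1 fps_mulDl fps_one_neq0.

Definition fpsX : fps R := Fps (fun n => (n == 1%N)%:R).

Lemma fps0E n : (0 : fps R) n = 0. Proof. by []. Qed.
Lemma fps1E n : (1 : fps R) n = (n == 0%N)%:R. Proof. by []. Qed.
Lemma fpsNE f n : (- f) n = - f n. Proof. by []. Qed.
Lemma fpsDE f g n : (f + g) n = f n + g n. Proof. by []. Qed.
Lemma fpsME f g n : (f * g) n = \sum_(i < n.+1) f i * g (n - i)%N.
Proof. by []. Qed.

End FpsRing.

(* A series is a unit of R[[q]] iff its constant coefficient is a unit of R. *)
Section FpsInverse.
Variable R : comUnitRingType.
Implicit Types f g : fps R.

Definition fps_unit : {pred fps R} := fun f => f 0%N \is a GRing.unit.

(* [:: g 0; ...; g n] for the series g such that f * g = 1 *)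
Fixpoint fps_inv_seq f n : seq R :=
  if n is n'.+1 then
    let s := fps_inv_seq f n' in
    rcons s (- (f 0%N)^-1 * \sum_(i < n) f i.+1 * s`_(n' - i))
  else [:: (f 0%N)^-1].

Definition fps_inv f : fps R :=
  if fps_unit f then Fps (fun n => (fps_inv_seq f n)`_n) else f.

Lemma size_fps_inv_seq f n : size (fps_inv_seq f n) = n.+1.
Proof. by elim: n => //= n IHn; rewrite size_rcons IHn. Qed.

Lemma nth_fps_inv_seq f n i : (i <= n)%N ->
  (fps_inv_seq f n)`_i = (fps_inv_seq f i)`_i.
Proof.
elim: n => [|n IHn]; first by rewrite leqn0 => /eqP->.
rewrite leq_eqVlt => /predU1P[-> //|]; rewrite ltnS => le_in.
by rewrite [LHS]/= nth_rcons size_fps_inv_seq ltnS le_in IHn.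
Qed.

Fact fps_mulVf : {in fps_unit, left_inverse 1 fps_inv *%R}.
Proof.
move=> f; rewrite unfold_in => f_unit; rewrite mulrC /fps_inv ifT //.
apply/fpsP => -[|n]; rewrite fpsME fps1E /=.
  by rewrite big_ord1 /= divrr.
rewrite big_ord_recl subn0 /= nth_rcons size_fps_inv_seq ltnn eqxx.
rewrite mulrA mulrN divrr // mulN1r addrC.
apply/eqP; rewrite subr_eq0; apply/eqP; apply: eq_bigr => i _ /=.
by rewrite /bump /= add1n subSS [in RHS]nth_fps_inv_seq ?leq_subr.
Qed.

Fact fps_unitPl f g : g * f = 1 -> fps_unit f.
Proof.
move=> /fpsP /(_ 0%N); rewrite fpsME fps1E big_ord1 /= => gf1.
by apply/unitrPr; exists (g 0%N); rewrite mulrC.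
Qed.

Fact fps_inv_out : {in [predC fps_unit], fps_inv =1 id}.
Proof. by move=> f nf_unit; rewrite /fps_inv ifN. Qed.

HB.instance Definition _ := GRing.ComNzRing_hasMulInverse.Build (fps R)
  fps_mulVf fps_unitPl fps_inv_out.

Lemma fps_unitE f : (f \is a GRing.unit) = (f 0%N \is a GRing.unit).
Proof. by []. Qed.

End FpsInverse.

(* (a; b)_n *)
Definition qpoch (A : comNzRingType) (a b : A) (n : nat) : A :=
  \prod_(t < n) (1 - a * b ^+ t).

(* 1 / (q; q)_j, with the convention that it is 0 for j < 0 *)
Definition inv_qfact (A : comUnitRingType) (q : A) (j : int) : A :=
  if j is Posz n then (qpoch q q n)^-1 else 0.

Definition qbinom (A : comUnitRingType) (q : A) (a b : nat) : A :=
  qpoch q q a * inv_qfact q b * inv_qfact q (a%:Z - b%:Z).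

(* x (x - 1) / 2, the division being exact *)
Definition binz2 (x : int) : int := (x * (x - 1) %/ 2)%Z.

(* The partitions of n into distinct parts, as their strictly decreasing
   sequences of positive parts. *)
Definition distinct_partition (n : nat) (l : seq nat) : bool :=
  [&& sorted gtn l, 0%N \notin l & sumn l == n].

(* Rows and columns are numbered from 1. *)
Definition part (l : seq nat) (i : nat) : nat := nth 0%N l i.-1.

Definition conj_part (l : seq nat) (j : nat) : nat :=
  count (fun x => j <= x)%N l.

Definition hook_length (l : seq nat) (i j : nat) : int :=
  (part l i)%:Z + (conj_part l j)%:Z - i%:Z - j%:Z + 1.

Definition has_fixed_hook (h : int) (m k : nat) (l : seq nat) : bool :=
  has (fun s => [&& part l s == k, (m <= part l s)%N &
                    hook_length l s m == s%:Z + h])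
      (iota 1 (size l)).

(* A partition of n has at most n parts, all at most n, whence the finite type
   over which we count. *)
Definition num_fixed_hook (h : int) (m k n : nat) : nat :=
  #|[set t : {bseq n of 'I_n.+1} |
      let l := map val (t : seq 'I_n.+1) in
      distinct_partition n l && has_fixed_hook h m k l]|.

Lemma distinct_partition_bounded n l : distinct_partition n l ->
  exists t : {bseq n of 'I_n.+1}, l = map val (t : seq 'I_n.+1).
Proof.
case/and3P => _ l0 /eqP def_n.
have le_sumn (s : seq nat) x : x \in s -> (x <= sumn s)%N.
  elim: s => //= y s IHs; rewrite inE => /predU1P[->|/IHs le_x].
    exact: leq_addr.
  exact: leq_trans le_x (leq_addl _ _).
have size_l : (size l <= n)%N.
  rewrite -{}def_n; elim: l l0 => //= x l IHl.
  rewrite inE negb_or eq_sym -lt0n => /andP[x_gt0 /IHl le_l].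
  by rewrite -add1n leq_add.
have size_t : (size (map (@inord n) l) <= n)%N by rewrite size_map.
exists (Bseq size_t); rewrite /= -map_comp -[LHS]map_id.
by apply/eq_in_map => x /le_sumn le_x; rewrite /= inordK // ltnS -def_n.
Qed.

(* The exponent of q in the summand of index s: it is negative only when the
   factor 1 / (q; q)_(s+k-h-m) is 0, so that the junk value of a negative power
   of the non-unit q never matters. *)
Lemma exponent_ge0 (m k s : nat) (h : int) :
  0 <= s%:Z + k%:Z - h - m%:Z ->
  0 <= s%:Z * (k%:Z + m%:Z) + k%:Z * (k%:Z - h - m%:Z + 1)
       + binz2 (s%:Z + k%:Z - m%:Z + 1 - h) + binz2 s%:Z.
Proof.
have binz2_ge0 (x : int) : 0 <= x -> 0 <= binz2 x.
  by move=> x_ge0; rewrite /binz2 divz_ge0 //; nia.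
move=> j_ge0; apply: addr_ge0; last exact: binz2_ge0.
by apply: addr_ge0; [nia | apply: binz2_ge0; lia].
Qed.

(* Main.v *)
(* A part k in row r of a partition into distinct parts has r - 1 larger parts;
   if s parts lie in [m, k), then the m-th column has length r + s, and the hook
   condition k + (r + s) - r - m + 1 = r + h says that there are exactly
   j = s + k - h - m parts larger than k.  The parts below m, in [m, k), equal to
   k and larger than k are then independent.  They contribute (-q; q)_(m-1), the
   coefficient of X^s in prod_(m <= i < k) (1 + q^i X), q^k, and the coefficient
   of X^j in prod_(i > k) (1 + q^i X); the q-binomial theorem evaluates these
   coefficients.  Fixing n, the last product is truncated at i <= k + n, so that
   everything takes place over the finite set {0, ..., k + n}. *)

Require Import Defs.
From mathcomp Require Import all_boot all_order all_algebra.
From mathcomp Require Import zify ring.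

Set Implicit Arguments.
Unset Strict Implicit.
Unset Printing Implicit Defensive.

Import GRing.Theory.
Local Open Scope ring_scope.

(** * Products of 1 + q^i X and sets of parts with prescribed counts *)

Section SubsetSeries.
Variables (A : comNzRingType) (q : A).

(** The coefficient of X^s is the sum of q^(sum of S) over the s-element subsets S of [a, b). *)
Definition subset_poly (a b : nat) : {poly A} :=
  \prod_(a <= i < b) (1 + q ^+ i *: 'X).

Lemma qpochS (a b : A) n : qpoch a b n.+1 = qpoch a b n * (1 - a * b ^+ n).
Proof. by rewrite /qpoch big_ord_recr. Qed.

Lemma size_subset_poly a b : (a <= b)%N ->
  (size (subset_poly a b) <= (b - a).+1)%N.
Proof.
move=> /subnKC <-; rewrite addKn; elim: (b - a)%N => [|M IHM].
  by rewrite addn0 /subset_poly big_geq // size_poly1.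
rewrite addnS /subset_poly big_nat_recr ?leq_addr //= mulrDr mulr1.
rewrite (leq_trans (size_polyD _ _)) // geq_max (leq_trans IHM) //=.
rewrite -scalerAr (leq_trans (size_scale_leq _ _)) //.
by rewrite (leq_trans (size_polyMleq _ _)) // size_polyX addn2.
Qed.

(* The q-binomial theorem, cleared of denominators. *)
Lemma coef_subset_poly a s t :
  (subset_poly a (a + (s + t)))`_s * (qpoch q q s * qpoch q q t)
    = q ^+ (a * s + 'C(s, 2)) * qpoch q q (s + t).
Proof.
have [M] := ubnP (s + t); elim: M s t => // M IHM s t; rewrite ltnS => le_stM.
case: s => [|s] in le_stM *.
  rewrite muln0 bin0n !mul1r [qpoch q q 0]/qpoch big_ord0 mul1r add0n.
  rewrite -horner_coef0 /subset_poly horner_prod big1 ?mul1r // => i _.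
  by rewrite !hornerE.
(* Pascal rule: an (s+1)-subset either avoids or contains the top element a + s + t. *)
have P_rec : (subset_poly a (a + (s.+1 + t)))`_s.+1 =
    (subset_poly a (a + (s + t)))`_s.+1
    + q ^+ (a + (s + t)) * (subset_poly a (a + (s + t)))`_s.
  rewrite addSn addnS /subset_poly big_nat_recr ?leq_addr //= mulrDr mulr1 coefD.
  by rewrite -scalerAr coefZ coefMX.
rewrite P_rec mulrDl.
have IHs := IHM s t le_stM.
(* Up to a common factor the two terms are q^t (1 - q^(s+1)) and 1 - q^t, which add up to 1 -
   q^(s+1+t). *)
have -> : q ^+ (a + (s + t)) * (subset_poly a (a + (s + t)))`_s
    * (qpoch q q s.+1 * qpoch q q t)
  = q ^+ (a * s.+1 + 'C(s.+1, 2)) * qpoch q q (s + t)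
    * (q ^+ t * (1 - q ^+ s.+1)).
  rewrite qpochS -exprS.
  transitivity (q ^+ (a + (s + t)) * (1 - q ^+ s.+1)
      * ((subset_poly a (a + (s + t)))`_s * (qpoch q q s * qpoch q q t))).
    by ring.
  by rewrite IHs binS bin1 mulnS !exprD; ring.
have -> : (subset_poly a (a + (s + t)))`_s.+1 * (qpoch q q s.+1 * qpoch q q t)
  = q ^+ (a * s.+1 + 'C(s.+1, 2)) * qpoch q q (s + t) * (1 - q ^+ t).
  case: t => [|t] in le_stM IHs P_rec *.
    (* For t = 0 the degree is at most s, so the coefficient vanishes, as does 1 - q^0. *)
    rewrite nth_default ?expr0 ?subrr ?mulr0 ?mul0r //.
    by rewrite (leq_trans (size_subset_poly _)) ?leq_addr // addKn addn0.
  rewrite -addSnnS [qpoch q q t.+1]qpochS -exprS.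
  have <- := IHM s.+1 t; first ring.
  by rewrite addSnnS.
by rewrite addSn qpochS -exprS -addSn [q ^+ (s.+1 + t)]exprD; ring.
Qed.

(* The inner variable marks the parts in [m, k), the outer one those above k. *)
Definition part_weight (m k i : nat) : {poly {poly A}} :=
  if i == 0%N then 0 else
  (q ^+ i)%:P%:P * ((if (m <= i < k)%N then 'X%:P else 1)
                    * (if (k < i)%N then 'X else 1)).

(** In each factor [part_weight] stands for taking i and [(i != k)%:R] for leaving it out: 0 cannot
    be taken, k cannot be left out. The range is then cut at 0, m and k. *)
Lemma prod_part_weight (N m : nat) (k : 'I_N.+1) : (0 < m <= k)%N ->
  \prod_(i < N.+1) (part_weight m k i + (i != k)%:R)
  = (qpoch (- q) q m.-1 * q ^+ k)%:P%:P * (subset_poly m k)%:P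
    * map_poly polyC (subset_poly k.+1 N.+1).
Proof.
case/andP=> m_gt0 le_mk.
pose F (i : nat) := part_weight m k i + (i != k)%:R.
rewrite -(big_mkord xpredT F).
have lekN : (k < N.+1)%N by [].
rewrite (big_cat_nat (leq0n _) lekN) /= big_nat_recr //=.
rewrite (big_cat_nat (leq0n _) le_mk) /= [X in X * _ * _ * _]big_ltn //.
congr (_ * _).
  rewrite mulrAC; congr (_ * _); last first.
    rewrite rmorph_prod; apply: eq_big_nat => i /andP[lemi ltik].
    rewrite /F /part_weight /= lemi ltik (gtn_eqF (leq_trans m_gt0 lemi)) (ltn_eqF ltik).
    rewrite (ltnNge k) (ltnW ltik) /= mulr1.
    by rewrite polyCD polyC1 addrC -mul_polyC polyCM.
  have k_gt0 : (0 < k)%N by apply: leq_trans le_mk.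
  have -> : F 0%N = 1 by rewrite /F /part_weight /= (ltn_eqF k_gt0) add0r.
  have -> : F k = (q ^+ k)%:P%:P.
    by rewrite /F /part_weight ltnn andbF eqxx (gtn_eqF k_gt0) /= !mulr1 addr0.
  rewrite mul1r !polyCM; congr (_ * _).
  rewrite /qpoch !rmorph_prod big_add1 big_mkord.
  apply: eq_bigr => i _; have lt_im : (i.+1 < m)%N by rewrite -ltn_predRL.
  have lt_ik := leq_trans lt_im le_mk.
  rewrite /F /part_weight /= leqNgt lt_im (ltnNge k) (ltnW lt_ik) (ltn_eqF lt_ik) /= !mulr1.
  by rewrite mulNr opprK -exprS !polyCD !polyC1 addrC.
rewrite rmorph_prod; apply: eq_big_nat => i /andP[ltki _].
rewrite /F /part_weight (gtn_eqF (leq_ltn_trans (leq0n k) ltki)) ltki.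
rewrite (ltnNge i) (ltnW ltki) andbF (gtn_eqF ltki) /= mul1r.
rewrite rmorphD /= map_polyZ map_polyX -[X in map_poly _ X]polyC1 map_polyC /=.
by rewrite !polyC1 mul_polyC addrC.
Qed.

(** Distributivity turns the product of [prod_part_weight] into one monomial per set B, whose
    degrees in the two variables are the two counts; extracting coefficients selects the sets. *)
Lemma sum_subset (N m s j : nat) (k : 'I_N.+1) : (0 < m <= k)%N ->
  \sum_(B : {set 'I_N.+1} | [&& ord0 \notin B, k \in B,
      #|[set i in B | (m <= i < k)%N]| == s & #|[set i in B | (k < i)%N]| == j])
     q ^+ (\sum_(i in B) i)
  = qpoch (- q) q m.-1 * q ^+ k * (subset_poly m k)`_s
    * (subset_poly k.+1 N.+1)`_j.
Proof.
move=> /prod_part_weight /(congr1 (fun p : {poly {poly A}} => p`_j`_s)).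
rewrite -mulrA !coefCM coef_map /= coefMC mulrA => <-.
rewrite bigA_distr !coef_sum big_mkcond /=; apply: eq_bigr => B _.
(* A set containing 0 or missing k has a zero factor. *)
have [B0 | B0] /= := boolP (ord0 \in B).
  by rewrite (bigD1 ord0) //= B0 ?eqxx mul0r !coef0.
have [Bk | Bk] /= := boolP (k \in B); last first.
  by rewrite (bigD1 k) //= (negbTE Bk) eqxx mul0r !coef0.
have -> : \prod_i (if i \in B then part_weight m k i else (i != k)%:R)
  = (q ^+ (\sum_(i in B) i))%:P%:P * ('X ^+ #|[set i in B | (m <= i < k)%N]|)%:P
    * 'X ^+ #|[set i in B | (k < i)%N]|.
  rewrite rmorphXn /= -!prodr_const expr_sum !rmorph_prod.
  transitivity (\prod_(i in B) ((q ^+ i)%:P%:P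
      * ((if (m <= i < k)%N then 'X%:P else 1)
         * (if (k < i)%N then 'X else 1)) : {poly {poly A}})).
    rewrite [RHS]big_mkcond; apply: eq_bigr => i _.
    have [Bi|Bi] := ifPn; last by case: eqP Bi => // ->; rewrite Bk.
    by rewrite /part_weight ifN //; apply: contraNneq B0 => i0;
       rewrite -(_ : i = ord0) //; apply: val_inj.
  rewrite !big_split /= mulrA -!big_mkcondr; congr (_ * _ * _).
    by apply: eq_bigr => i _; rewrite rmorphXn.
    by apply: eq_bigl => i; rewrite inE.
  by apply: eq_bigl => i; rewrite inE.
rewrite -polyCM coefCM coefXn [j == _]eq_sym.
case: (_ == j); last by rewrite andbF mulr0 coef0.
rewrite mulr1 andbT coefCM coefXn [s == _]eq_sym.
by case: (_ == s); rewrite ?mulr1 ?mulr0.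
Qed.
End SubsetSeries.

(** * Coefficients of formal power series *)

Section Coefficients.
Variable R : comNzRingType.
Implicit Types f g : fps R.

Lemma fps_sumE (I : Type) (r : seq I) (P : pred I) (F : I -> fps R) n :
  (\sum_(i <- r | P i) F i) n = \sum_(i <- r | P i) F i n.
Proof. exact: (big_morph (fun f : fps R => f n) (fun f g => erefl) erefl). Qed.

Lemma fpsXME f n : (fpsX R * f) n = if n is n'.+1 then f n' else 0.
Proof.
rewrite fpsME big_ord_recl /= mul0r add0r; case: n => [|n].
  by rewrite big_ord0.
rewrite big_ord_recl /= mul1r subn1 big1 ?addr0 // => i _.
by rewrite mul0r.
Qed.

Lemma fpsXnME a f n : (fpsX R ^+ a * f) n = if (n < a)%N then 0 else f (n - a)%N.
Proof.
elim: a n => [|a IHa] n; first by rewrite expr0 mul1r subn0.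
by rewrite exprS -mulrA fpsXME; case: n.
Qed.

Lemma fpsXnE a n : (fpsX R ^+ a) n = (n == a)%:R.
Proof.
rewrite -[_ ^+ a]mulr1 fpsXnME fps1E; case: ltngtP => // [lt_an | ->].
  by rewrite subn_eq0 leqNgt lt_an.
by rewrite subnn.
Qed.

Lemma fps_coefM f g1 g2 n :
  (forall i, (i <= n)%N -> g1 i = g2 i) -> (f * g1) n = (f * g2) n.
Proof.
by move=> eq_g; rewrite !fpsME; apply: eq_bigr => i _; rewrite eq_g ?leq_subr.
Qed.
End Coefficients.

(** * q-factorials and truncation of the infinite product *)

Section QFactorials.
Variable R : comUnitRingType.
Notation q := (fpsX R).

Lemma qfact_unit n : qpoch q q n \is a GRing.unit.
Proof.
apply: rpred_prod => i _; rewrite fps_unitE fpsDE fpsNE fps1E -exprS fpsXnE.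
by rewrite subr0 unitr1.
Qed.

Lemma qfact_split t j : qpoch q q (t + j) = qpoch q q t * qpoch (q ^+ t.+1) q j.
Proof.
rewrite /qpoch big_split_ord; congr (_ * _); apply: eq_bigr => i _ /=.
by rewrite -exprS -exprD.
Qed.

(** Each factor is 1 modulo q^a; this controls the truncation error below. *)
Lemma qpoch_approx a j : exists g, qpoch (q ^+ a) q j = 1 + q ^+ a * g.
Proof.
elim: j => [|j [g IHj]]; first by exists 0; rewrite /qpoch big_ord0 mulr0 addr0.
exists (g - q ^+ j - q ^+ a * g * q ^+ j); rewrite qpochS IHj; ring.
Qed.

(* The right-hand side is the series of the infinite product
   prod_(i >= a) (1 + q^i X), which the truncation at a + n computes up to q^n. *)
Lemma coef_subset_poly_approx a n j i : (0 < a)%N -> (i <= n)%N ->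
  (subset_poly q a (a + n))`_j i
    = (q ^+ (a * j + 'C(j, 2)) * (qpoch q q j)^-1) i.
Proof.
(* If j > n, the left side is zero as n factors give degree at most n, and the right side starts at
   an exponent at least j, since a > 0. *)
move=> a_gt0 le_in; have [lt_nj | /subnKC def_n] := ltnP n j.
  rewrite nth_default ?fps0E; last first.
    by rewrite (leq_trans (size_subset_poly _ _)) ?leq_addr // addKn.
  rewrite fpsXnME ifT // (leq_ltn_trans le_in) // (leq_trans lt_nj) //.
  by rewrite (leq_trans (leq_pmull j a_gt0)) ?leq_addr.
move: (n - j)%N def_n => t def_n; case: n / def_n le_in => le_in.
have [g def_g] := qpoch_approx t.+1 j.
(* The quotient of (q; q)_(t+j) by (q; q)_t is 1 + q^(t+1) g; the error term has order at least j +
   t + 1 > n. *)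
have -> : (subset_poly q a (a + (j + t)))`_j =
    q ^+ (a * j + 'C(j, 2)) * (qpoch q q j)^-1
    + q ^+ (a * j + 'C(j, 2) + t.+1) * (g * (qpoch q q j)^-1).
  apply: (mulIr (qfact_unit j)); apply: (mulIr (qfact_unit t)).
  rewrite -mulrA coef_subset_poly (addnC j t) qfact_split def_g.
  have qj := mulVr (qfact_unit j).
  rewrite (exprD _ _ t.+1); move: (_ ^-1) qj => u qj.
  rewrite [RHS](_ : _ = q ^+ (a * j + 'C(j, 2)) * (u * qpoch q q j)
    * (1 + q ^+ t.+1 * g) * qpoch q q t); first by rewrite qj; ring.
  ring.
rewrite fpsDE [X in _ + X]fpsXnME ifT ?addr0 //.
rewrite (leq_ltn_trans le_in) // addnS ltnS leq_add2r.
by rewrite (leq_trans (leq_pmull j a_gt0)) ?leq_addr.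
Qed.
End QFactorials.


(** * Fixed hooks in terms of counts of parts *)

Lemma all_countE (T : Type) (p : pred T) s : all p s -> count p s = size s.
Proof. by rewrite all_count => /eqP. Qed.

Lemma gtn_trans : transitive gtn.
Proof. exact: rev_trans ltn_trans. Qed.

Lemma has_fixed_hookE (h : int) m k l : sorted gtn l -> (m <= k)%N ->
  has_fixed_hook h m k l = (k \in l) &&
    ((count (ltn k) l)%:Z
       == (count (fun x => (m <= x < k)%N) l)%:Z + k%:Z - h - m%:Z).
Proof.
move=> l_sorted le_mk; have l_uniq := sorted_uniq gtn_trans ltnn l_sorted.
have [kl | kl] /= := boolP (k \in l); last first.
  apply/hasPn => s; rewrite mem_iota /part => /andP[s_gt0 lt_s].
  apply: contra kl => /and3P[/eqP <- _ _]; apply: mem_nth.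
  by rewrite -ltnS prednK.
(* [l1] holds the parts above k and [l2] those below, so k lies in row [(size l1).+1]. *)
case/splitPr: kl l_sorted l_uniq => l1 l2.
rewrite (sorted_pairwise gtn_trans) pairwise_cat /= allrel_consr -andbA.
case/and5P=> gt_l1 _ _ lt_l2 _ l_uniq.
have c1 : count (ltn k) (l1 ++ k :: l2) = size l1.
  rewrite count_cat /= ltnn (all_countE gt_l1).
  rewrite (@eq_in_count _ _ pred0) ?count_pred0 ?addn0 //.
  move=> x /(allP lt_l2) /= lt_xk.
  by rewrite ltnNge (ltnW lt_xk).
have c2 : count (fun x => m <= x < k)%N (l1 ++ k :: l2) = count (leq m) l2.
  rewrite count_cat /= ltnn andbF add0n.
  rewrite (@eq_in_count _ _ pred0 l1) ?count_pred0 => [|x /(allP gt_l1) /= lt_kx].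
    by apply: eq_in_count => x /(allP lt_l2) /= ->; rewrite andbT.
  by rewrite [(x < k)%N]ltnNge (ltnW lt_kx) andbF.
have c3 : conj_part (l1 ++ k :: l2) m = (size l1 + 1 + count (leq m) l2)%N.
  rewrite /conj_part count_cat /= le_mk addnA (@all_countE _ (leq m)) //.
  apply/allP => x /(allP gt_l1) /= lt_kx.
  exact: leq_trans le_mk (ltnW lt_kx).
have k_l1 : k \notin l1 by apply/negP => /(allP gt_l1); rewrite /= ltnn.
have ind_k : index k (l1 ++ k :: l2) = size l1.
  by rewrite index_cat (negbTE k_l1) /= eqxx addn0.
rewrite c1 c2; apply/hasP/eqP => [[s] | def_l1].
  rewrite mem_iota => /andP[s_gt0 lt_s] /and3P[/eqP s_k _ /eqP].
  rewrite /hook_length c3.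
  (* Distinctness leaves only one row with part k. *)
  have s_l1 : s = (size l1).+1.
    have lt_s1 : (s.-1 < size (l1 ++ k :: l2))%N by rewrite -ltnS prednK.
    have := index_uniq 0%N lt_s1 l_uniq.
    by rewrite -[nth _ _ _]/(part _ s) s_k ind_k => ->; rewrite prednK.
  rewrite s_k s_l1; lia.
exists (size l1).+1.
  by rewrite mem_iota size_cat /= addnS add1n !ltnS leq_addr.
rewrite /hook_length c3 /part nth_cat ltnn subnn /= eqxx le_mk /=; apply/eqP.
  rewrite !(intS (size l1)) !PoszD def_l1; ring.
Qed.

(** * Partitions into distinct parts as subsets of {0, ..., N} *)

Section PartsAsSets.
Variable N : nat.
Implicit Types (B : {set 'I_N.+1}) (l : seq nat).

Definition parts_of B : seq nat := [seq val i | i <- rev (enum B)].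

Definition set_of_parts l : {set 'I_N.+1} := [set i | val i \in l].

Lemma sorted_parts_of B : sorted gtn (parts_of B).
Proof.
rewrite /parts_of map_rev rev_sorted {1}/enum_mem -enumT sorted_map.
apply: sorted_filter => [x y z|]; first exact: ltn_trans.
by have := iota_ltn_sorted 0 N.+1; rewrite -val_enum_ord sorted_map.
Qed.

Lemma mem_parts_of B (i : 'I_N.+1) : (val i \in parts_of B) = (i \in B).
Proof. by rewrite (mem_map val_inj) mem_rev mem_enum. Qed.

Lemma parts_ofK : cancel parts_of set_of_parts.
Proof. by move=> B; apply/setP => i; rewrite inE mem_parts_of. Qed.

Lemma count_parts_of (p : pred nat) B :
  count p (parts_of B) = #|[set i in B | p i]|.
Proof.
rewrite count_map count_rev -sum1_card -sum1_count big_enum_cond /=.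
by apply: eq_bigl => i; rewrite inE.
Qed.

Lemma sumn_parts_of B : sumn (parts_of B) = (\sum_(i in B) i)%N.
Proof. by rewrite sumnE big_map big_rev big_enum. Qed.

Lemma set_of_partsK l : sorted gtn l -> all (geq N) l ->
  parts_of (set_of_parts l) = l.
Proof.
move=> l_sorted le_lN.
apply: (irr_sorted_eq gtn_trans ltnn) => // [|x]; first exact: sorted_parts_of.
apply/idP/idP => [/mapP[i] | lx]; first by rewrite mem_rev mem_enum inE => ? ->.
have lt_xN : (x < N.+1)%N by rewrite ltnS; exact: (allP le_lN).
by rewrite (mem_parts_of _ (Ordinal lt_xN)) inE.
Qed.

Lemma num_fixed_hook_sets (h : int) m (k : 'I_N.+1) n :
    (m <= k)%N -> (n <= N)%N ->
  num_fixed_hook h m k n =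
  #|[set B : {set 'I_N.+1} | [&& ord0 \notin B, k \in B,
       #|[set i in B | (k < i)%N]|%:Z
         == #|[set i in B | (m <= i < k)%N]|%:Z + k%:Z - h - m%:Z
       & (\sum_(i in B) i == n)%N]]|.
Proof.
move=> le_mk le_nN; rewrite /num_fixed_hook.
pose parts (t : {bseq n of 'I_n.+1}) := map val (t : seq 'I_n.+1).
pose cond l := distinct_partition n l && has_fixed_hook h m k l.
have condE B : cond (parts_of B) = (B \in [set B : {set 'I_N.+1} |
    [&& ord0 \notin B, k \in B,
       #|[set i in B | (k < i)%N]|%:Z
         == #|[set i in B | (m <= i < k)%N]|%:Z + k%:Z - h - m%:Z
       & (\sum_(i in B) i == n)%N]]).
  rewrite inE /cond has_fixed_hookE ?sorted_parts_of // /distinct_partition.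
  rewrite sorted_parts_of !count_parts_of sumn_parts_of.
  rewrite (mem_parts_of B ord0) (mem_parts_of B k) /=.
  by rewrite -!andbA [(_ == n)%N && _]andbC -!andbA.
have parts_val t : cond (parts t) -> parts_of (set_of_parts (parts t)) = parts t.
  move=> /andP[/and3P[t_sorted _ _] _]; apply: set_of_partsK => //.
  apply/allP => _ /mapP[i _ ->] /=; rewrite (leq_trans _ le_nN) //.
  by rewrite -ltnS.
(* [set_of_parts] is injective on the counted sequences, as [parts_of] inverts it there. *)
transitivity #|[set set_of_parts (parts t) | t in [set t | cond (parts t)]]|.
  rewrite card_in_imset // => t1 t2; rewrite !inE => /parts_val t1K /parts_val t2K.
  move=> eq_t; apply: val_inj; apply: (inj_map val_inj).
  by rewrite -[LHS]t1K -[RHS]t2K eq_t.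
congr #|pred_of_set _|; apply/setP => B; rewrite -condE.
apply/imsetP/idP => [[t] | Bcond].
  by rewrite inE => t_cond ->; rewrite parts_val.
have /distinct_partition_bounded[t def_t] : distinct_partition n (parts_of B).
  by case/andP: Bcond.
by exists t; rewrite ?inE /parts -def_t ?parts_ofK.
Qed.
End PartsAsSets.

(** * Exponents and assembly of the generating function *)

Lemma card_interval N m k (B : {set 'I_N.+1}) :
  (#|[set i in B | (m <= i < k)%N]| <= k - m)%N.
Proof.
rewrite cardE -(size_map val) -(size_iota m (k - m)).
apply: uniq_leq_size; first by rewrite map_inj_uniq ?enum_uniq //; exact: val_inj.
move=> x /mapP[i]; rewrite mem_enum inE mem_iota => /andP[_ /andP[le_mi lt_ik]] ->.
by rewrite le_mi subnKC // (leq_trans le_mi) // ltnW.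
Qed.

Lemma binz2_nat (n : nat) : binz2 n%:Z = 'C(n, 2)%:Z.
Proof.
rewrite /binz2; have -> : n%:Z * (n%:Z - 1) = 'C(n, 2)%:Z * 2.
  case: n => [|n]; first by rewrite mul0r.
  rewrite -[in RHS]PoszM (_ : 2 = 2`!)%N // bin_ffact ffactnS ffactn1 PoszM.
  by rewrite intS addrAC subrr add0r.
by rewrite mulzK.
Qed.

(* The right-hand side is the least sum of s distinct parts in [m, k), the part k
   and j distinct parts larger than k. *)
Lemma exponentE (m k s j : nat) (h : int) :
  s%:Z + k%:Z - h - m%:Z = j%:Z ->
  s%:Z * (k%:Z + m%:Z) + k%:Z * (k%:Z - h - m%:Z + 1)
    + binz2 (s%:Z + k%:Z - m%:Z + 1 - h) + binz2 s%:Z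
  = ((m * s + 'C(s, 2)) + k + (k.+1 * j + 'C(j, 2)))%:Z.
Proof.
move=> def_j.
have -> : s%:Z + k%:Z - m%:Z + 1 - h = j.+1%:Z by rewrite intS -def_j; ring.
rewrite !binz2_nat binS bin1; have -> : h = s%:Z + k%:Z - m%:Z - j%:Z by lia.
rewrite mulSn !PoszD !PoszM; ring.
Qed.

Theorem theorem2p4 (m k : nat) (h : int) (hm : (1 <= m)%N) (hk : (m <= k)%N) :
  let q : fps int := fpsX int in
  Fps (fun n => (num_fixed_hook h m k n)%:Z) =
  \sum_(0 <= s < (k - m).+1)
    q ^ (s%:Z * (k%:Z + m%:Z) + k%:Z * (k%:Z - h - m%:Z + 1)
         + binz2 (s%:Z + k%:Z - m%:Z + 1 - h) + binz2 s%:Z)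
    * qpoch (- q) q (m - 1)
    * inv_qfact q (s%:Z + k%:Z - h - m%:Z)
    * qbinom q (k - m) s.
Proof.
move=> q; apply/fpsP => n; rewrite [LHS]/=.
(* The bound N = k + n admits k and all parts up to n, and leaves exactly n values above k. *)
have lt_kN : (k < (k + n).+1)%N by rewrite ltnS leq_addr.
pose k' := Ordinal lt_kN.
rewrite (@num_fixed_hook_sets _ h m k') ?leq_addl //= big_mkord fps_sumE.
pose mid (B : {set 'I_(k + n).+1}) := #|[set i in B | (m <= i < k)%N]|.
pose large (B : {set 'I_(k + n).+1}) := #|[set i in B | (k < i)%N]|.
(* Sets are grouped by their number s of elements in [m, k), at most k - m by [card_interval];
   taking the coefficient of q^n imposes the sum n. *)
transitivity (\sum_(s < (k - m).+1) \sum_(B : {set 'I_(k + n).+1} |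
    [&& ord0 \notin B, k' \in B, mid B == s
      & (large B)%:Z == s%:Z + k%:Z - h - m%:Z])
    (q ^+ (\sum_(i in B) i)) n : int).
  rewrite -sum1_card -[LHS]natz natr_sum big_mkcond.
  rewrite [LHS](partition_big (fun B => inord (mid B) : 'I_(k - m).+1) xpredT) //=.
  apply: eq_bigr => s _; rewrite big_mkcond [RHS]big_mkcond; apply: eq_bigr => B _.
  rewrite inE -val_eqE /= inordK ?ltnS ?card_interval // -/(mid B) -/(large B).
  case: eqP => [->|_]; last by rewrite !andbF.
  rewrite fpsXnE [n == _]eq_sym; case: (ord0 \notin B); case: (k' \in B) => //=.
  by case: (_ == s%:Z + _ - _ - _); case: (_ == n).
apply: eq_bigr => s _.
have le_s : (s <= k - m)%N by rewrite -ltnS.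
(* For a negative value no set qualifies, and [inv_qfact] is 0 by convention. *)
case def_j: (s%:Z + k%:Z - h - m%:Z) => [j|j]; last first.
  by rewrite mulr0 mul0r fps0E big1 // => B /and4P[].
rewrite (exponentE def_j) -exprnP -fps_sumE.
rewrite sum_subset; last by rewrite hm hk.
set e1 := (m * s + 'C(s, 2))%N; set e2 := (k.+1 * j + 'C(j, 2))%N.
(* The range [m, k) is finite, so the q-binomial theorem applies exactly here. *)
have -> : (subset_poly q m k)`_s = q ^+ e1 * qbinom q (k - m) s.
  have qs := qfact_unit int s; have qt := qfact_unit int (k - m - s).
  apply: (mulIr qs); apply: (mulIr qt).
  have := coef_subset_poly q m s (k - m - s).
  rewrite (subnKC le_s) (subnKC hk) -mulrA => ->.
  rewrite /qbinom subzn //= -/e1 -!mulrA; congr (_ * _).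
  by rewrite [_^-1 * (_ * _)]mulrCA mulKr // mulVr // mulr1.
transitivity ((q ^+ k * qpoch (- q) q m.-1 * (q ^+ e1 * qbinom q (k - m) s)
    * (subset_poly q k.+1 (k.+1 + n))`_j) n).
  by congr (fcoef _ n); rewrite addSn /=; ring.
(* Only coefficients up to n matter, so the truncated product may be replaced by its limit. *)
rewrite (@fps_coefM _ _ _ (q ^+ e2 * (qpoch q q j)^-1)); last first.
  by move=> i; apply: coef_subset_poly_approx.
congr (fcoef _ n); rewrite subn1 !exprD /=; ring.
Qed.
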